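(* Let $Y$ be a Banach space and $1<p<q<\infty$. If $\ell_q$ isomorphically embeds into $Y$, then $Y$ is not a coarse quotient of any $\ell_p$-sum of finite-dimensional spaces. In particular, $\ell_q$ is not a coarse quotient of $\ell_p$.
   Context: $B(x,r)$ denotes the closed ball with center $x$ and radius $r$. For $\varepsilon\ge 0$ and a subset $A$ of a metric space $Y$, $A^{\varepsilon}:=\{y\in Y: d(y,a)\le\varepsilon \text{ for some } a\in A\}$. A mapping $f:X\to Y$ between metric spaces is coarsely continuous if for every $R>0$ there exists $S=S(R)>0$ such that $d(x,y)<R$ implies $d(f(x),f(y))<S$. Given a constant $K\ge 0$, $f$ is co-coarsely continuous with constant $K$ if for every $\epsilon>0$ there exists $\delta=\delta(\epsilon)>0$ such that for every $x\in X$, $B(f(x),\epsilon)\subset f(B(x,\delta))^K$. A mapping that is coarsely continuous and co-coarsely continuous with constant $K$ is called a coarse quotient mapping with constant $K$. $Y$ is a coarse quotient of $X$ if there exists a coarse quotient mapping from $X$ to $Y$ (with some constant $K\ge 0$; surjectivity is not required). ''$\ell_q$ isomorphically embeds into $Y$'' means $\ell_q$ is linearly isomorphic to a (closed) subspace of $Y$. *)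

(* Defs.v *)
From HB Require Import structures.
From mathcomp Require Import all_boot all_order all_algebra.
From mathcomp Require Import interval_inference finmap.
From mathcomp Require Import all_classical all_reals all_analysis.
From mathcomp Require Import ring.

Set Implicit Arguments.
Unset Strict Implicit.
Unset Printing Implicit Defensive.

Import Order.TTheory GRing.Theory Num.Theory.
Import numFieldNormedType.Exports.

Local Open Scope classical_set_scope.
Local Open Scope ring_scope.

(* Not the library's [closed_ball], which is the closure of the open ball and
   can be smaller in a general metric space. *)
Definition cball {R : realType} {Z : metricType R} (z : Z) (r : R) : set Z :=
  [set w | mdist w z <= r].

Definition enlargement {R : realType} {Z : metricType R} (A : set Z) (e : R) :
    set Z :=
  [set y | exists2 a, A a & mdist y a <= e].

Section coarse.
Context {R : realType} {X Y : metricType R}.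

Definition coarsely_continuous (f : X -> Y) : Prop :=
  forall r : R, 0 < r -> exists2 s : R, 0 < s &
    forall x y : X, mdist x y < r -> mdist (f x) (f y) < s.

Definition co_coarsely_continuous (K : R) (f : X -> Y) : Prop :=
  forall e : R, 0 < e -> exists2 d : R, 0 < d &
    forall x : X, cball (f x) e `<=` enlargement (f @` cball x d) K.

Definition coarse_quotient_mapping (K : R) (f : X -> Y) : Prop :=
  coarsely_continuous f /\ co_coarsely_continuous K f.

End coarse.

Definition coarse_quotient {R : realType} (Y X : metricType R) : Prop :=
  exists (K : R) (f : X -> Y), 0 <= K /\ coarse_quotient_mapping K f.

(* A normed module carries a pseudometric but no [metricType] structure in the
   library; this alias equips it with the metric of its norm. *)
Definition normed_metric (V : Type) : Type := V.

Section normed_metric.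
Context {R : realType} (V : normedModType R).

HB.instance Definition _ := PseudoMetric.copy (normed_metric V) V.

Let dist (x y : normed_metric V) : R := `|(x : V) - (y : V)|.

Let dist_ge0 x y : 0 <= dist x y. Proof. exact: normr_ge0. Qed.

Let dist_positivity x y : dist x y = 0 -> x = y.
Proof. by move/normr0_eq0/eqP; rewrite subr_eq0 => /eqP. Qed.

Let ball_dist (x : normed_metric V) d : ball x d = [set y | dist x y < d].
Proof. by rewrite -[LHS]/(@ball R V x d) -ball_normE. Qed.

HB.instance Definition _ := @PseudoMetric_isMetric.Build R (normed_metric V)
  dist dist_ge0 dist_positivity ball_dist.

End normed_metric.

Lemma normed_metricE {R : realType} (V : normedModType R)
    (x y : normed_metric V) : mdist x y = `|(x : V) - (y : V)|.
Proof. by []. Qed.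

(* T is a linear homeomorphism of X onto the closed subspace range T of Y,
   with inverse S. *)
Definition isomorphically_embeds {R : realType} (X Y : normedModType R) :
    Prop :=
  exists T : {linear X -> Y},
    [/\ continuous T, closed (range T) &
        exists2 S : Y -> X, cancel T S & {within range T, continuous S}].

Definition finite_dimensional {R : realType} (V : lmodType R) : Prop :=
  exists (n : nat) (e : 'I_n -> V),
    forall v : V, exists c : 'I_n -> R, v = \sum_(i < n) c i *: e i.

Lemma esumZ_EFin {R : realType} {I : choiceType} (c : R) (a : I -> \bar R) :
  0 <= c -> (forall i, 0 <= a i)%E ->
  (\esum_(i in [set: I]) (c%:E * a i) = c%:E * \esum_(i in [set: I]) a i)%E.
Proof.
have le1 (d : R) b : 0 <= d -> (forall i, 0 <= b i)%E ->
    (\esum_(i in [set: I]) (d%:E * b i) <= d%:E * \esum_(i in [set: I]) b i)%E.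
  move=> d0 b0; apply: ge_ereal_sup => _ [A [finA _] <-].
  rewrite fsbig_finite//= -ge0_sume_distrr//.
  rewrite lee_wpmul2l ?lee_fin// -fsbig_finite//.
  by apply: esum_ge; exists A.
move=> c0 a0; apply/eqP; rewrite eq_le le1//=.
have [->|cN0] := eqVneq c 0.
  by rewrite mul0e esum_ge0// => i _; rewrite mul0e.
have cp : 0 < c by rewrite lt_neqAle eq_sym cN0.
rewrite -lee_pdivlMl//.
have ca0 i : (0 <= c%:E * a i)%E by rewrite mule_ge0 ?lee_fin.
apply: le_trans (le1 c^-1 _ _ ca0); last by rewrite invr_ge0.
by apply: le_esum => i _; rewrite muleA -EFinM mulVf// mul1e.
Qed.

(* The l_p-sum of a family of normed spaces, as a normed space.  The record
   carries the proof that 1 <= p because the triangle inequality needs it. *)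
Record lp_sum {R : realType} (p : R) (p1 : 1 <= p) (I : choiceType)
    (E : I -> normedModType R) := LpSum {
  lp_val :> forall i, E i;
  lp_summable : (\esum_(i in [set: I]) (`|lp_val i| `^ p)%:E < +oo)%E
}.

Section lp_sum_theory.
Context {R : realType} {p : R} {p1 : 1 <= p} {I : choiceType}.
Context {E : I -> normedModType R}.

Local Notation lp := (lp_sum p1 E).

Let esump (x : forall i, E i) : \bar R :=
  (\esum_(i in [set: I]) (`|x i| `^ p)%:E)%E.

Let p0 : 0 < p. Proof. exact: lt_le_trans p1. Qed.

Let esump_ge0 x : (0 <= esump x)%E.
Proof. by apply: esum_ge0 => i _; rewrite lee_fin powR_ge0. Qed.

Lemma lp_sumP (x y : lp) : (forall i, x i = y i) -> x = y.
Proof.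
case: x y => [x sx] [y sy] /= xy.
have {}xy : x = y by apply: functional_extensionality_dep.
by rewrite xy in sx *; congr LpSum; exact: bool_irrelevance.
Qed.

Let esumpZ (a : R) x :
  esump (fun i => a *: x i) = ((`|a| `^ p)%:E * esump x)%E.
Proof.
rewrite /esump -esumZ_EFin ?powR_ge0//.
by apply: eq_esum => i _; rewrite normrZ powRM// EFinM.
Qed.

Let powR_div (u a : R) : 0 <= u -> 0 < a -> (u / a) `^ p = u `^ p / a `^ p.
Proof.
move=> u0 a0; have ap0 : a `^ p != 0 by rewrite gt_eqF// powR_gt0.
apply: (mulIf ap0); rewrite divfK// -powRM ?divr_ge0 ?(ltW a0)//.
by rewrite divfK// gt_eqF.
Qed.

Let powRD_conv (a b u v : R) : 0 < a -> 0 < b -> 0 <= u -> 0 <= v ->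
  (u + v) `^ p <= (a + b) `^ p *
    (a / (a + b) / a `^ p * u `^ p + b / (a + b) / b `^ p * v `^ p).
Proof.
move=> a0 b0 u0 v0; have ab0 : 0 < a + b by rewrite addr_gt0.
have t0 : 0 <= a / (a + b) by rewrite divr_ge0// ltW.
have t1 : a / (a + b) <= 1 by rewrite ler_pdivrMr// mul1r lerDl ltW.
have := convex_powR p1 (Itv01 t0 t1).
move=> /(_ (u / a) (v / b)); rewrite !inE/= !in_itv/= !andbT.
move=> /(_ (divr_ge0 u0 (ltW a0)) (divr_ge0 v0 (ltW b0))).
rewrite !convRE/=.
have -> : unstable.onem (a / (a + b)) = b / (a + b).
  by rewrite /unstable.onem -{1}(divff (lt0r_neq0 ab0)) -mulrBl addrC addKr.
set c := conv _ _ _; have -> : c = (u + v) / (a + b).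
  rewrite /c [LHS]convRE/= -[unstable.onem _]/(1 - a / (a + b)).
  by field; rewrite !lt0r_neq0.
rewrite !powR_div ?addr_ge0// ler_pdivrMr ?powR_gt0// mulrC.
by rewrite !(mulrA _ (_ `^ p)) -!mulrA ![(_ `^ p)^-1 * _]mulrC.
Qed.

Let esumpD (a b : R) (x y : forall i, E i) : 0 < a -> 0 < b ->
  (esump x <= (a `^ p)%:E -> esump y <= (b `^ p)%:E ->
   esump (fun i => x i + y i)%R <= ((a + b) `^ p)%:E)%E.
Proof.
move=> a0 b0 xa yb; have ab0 : 0 < a + b by rewrite addr_gt0.
set s := a / (a + b) / a `^ p; set t := b / (a + b) / b `^ p.
have s0 : 0 <= s by rewrite !divr_ge0 ?powR_ge0// ltW.
have t0 : 0 <= t by rewrite !divr_ge0 ?powR_ge0// ltW.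
apply: (@le_trans _ _ (\esum_(i in [set: I]) (((a + b) `^ p)%:E *
    (s%:E * (`|x i| `^ p)%:E + t%:E * (`|y i| `^ p)%:E)))%E).
  apply: le_esum => i _.
  rewrite -[X in (_ <= X)%E]/(((a + b) `^ p *
    (s * `|x i| `^ p + t * `|y i| `^ p))%:E) lee_fin.
  apply: le_trans (powRD_conv a0 b0 (normr_ge0 _) (normr_ge0 _)).
  by rewrite ge0_ler_powR ?(ltW p0) ?nnegrE ?addr_ge0// ler_normD.
have sx0 i : (0 <= s%:E * (`|x i| `^ p)%:E)%E.
  by rewrite mule_ge0 ?lee_fin ?powR_ge0.
have ty0 i : (0 <= t%:E * (`|y i| `^ p)%:E)%E.
  by rewrite mule_ge0 ?lee_fin ?powR_ge0.
rewrite esumZ_EFin ?powR_ge0//; last by move=> i; rewrite adde_ge0.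
rewrite esumD// !esumZ_EFin//; [|by move=> i; rewrite lee_fin powR_ge0..].
rewrite -[leRHS]mule1 lee_wpmul2l ?lee_fin ?powR_ge0//.
have -> : 1%E = (s * a `^ p + t * b `^ p)%:E.
  rewrite /s /t !divfK ?lt0r_neq0 ?powR_gt0// -mulrDl divff//.
  exact: lt0r_neq0.
by rewrite EFinD !EFinM leeD// lee_wpmul2l.
Qed.

Definition lp_norm (x : lp) : R :=
  fine (\esum_(i in [set: I]) (`|x i| `^ p)%:E)%E `^ p^-1.

Let lp_norm_ge0 x : 0 <= lp_norm x. Proof. exact: powR_ge0. Qed.

Lemma lp_normX x :
  ((lp_norm x `^ p)%:E = \esum_(i in [set: I]) (`|x i| `^ p)%:E)%E.
Proof.
rewrite /lp_norm -powRrM mulVf ?gt_eqF// powRr1 ?fine_ge0 ?esump_ge0//.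
by rewrite fineK// ge0_fin_numE ?esump_ge0// lp_summable.
Qed.

Let esump_ltyD (x y : lp) : (esump (fun i => x i + y i)%R < +oo)%E.
Proof.
have leN (z : lp) : (esump z <= ((lp_norm z + 1) `^ p)%:E)%E.
  rewrite /esump -lp_normX lee_fin ge0_ler_powR ?(ltW p0) ?nnegrE ?addr_ge0//.
  by rewrite lerDl.
by apply: le_lt_trans (esumpD _ _ (leN x) (leN y)) _;
  rewrite ?ltry// ltr_wpDl.
Qed.

Let esump_ltyZ (a : R) (x : lp) : (esump (fun i => a *: x i)%R < +oo)%E.
Proof. by rewrite esumpZ /esump -lp_normX -EFinM ltry. Qed.

Let esump_lty0 : (esump (fun i => 0%R) < +oo)%E.
Proof. by rewrite /esump esum1// => i _; rewrite normr0 powR0// gt_eqF. Qed.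

Let esump_ltyN (x : lp) : (esump (fun i => - x i)%R < +oo)%E.
Proof.
rewrite (_ : esump _ = esump x) ?lp_summable//.
by apply: eq_esum => i _; rewrite normrN.
Qed.

Definition lp_add (x y : lp) : lp := LpSum p1 (esump_ltyD x y).
Definition lp_scale (a : R) (x : lp) : lp := LpSum p1 (esump_ltyZ a x).
Definition lp_zero : lp := LpSum p1 esump_lty0.
Definition lp_opp (x : lp) : lp := LpSum p1 (esump_ltyN x).

HB.instance Definition _ := gen_eqMixin lp.
HB.instance Definition _ := gen_choiceMixin lp.

Let lp_addA : associative lp_add.
Proof. by move=> x y z; apply: lp_sumP => i /=; rewrite addrA. Qed.
Let lp_addC : commutative lp_add.
Proof. by move=> x y; apply: lp_sumP => i /=; rewrite addrC. Qed.
Let lp_add0 : left_id lp_zero lp_add.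
Proof. by move=> x; apply: lp_sumP => i /=; rewrite add0r. Qed.
Let lp_addN : left_inverse lp_zero lp_opp lp_add.
Proof. by move=> x; apply: lp_sumP => i /=; rewrite addNr. Qed.

HB.instance Definition _ :=
  GRing.isZmodule.Build lp lp_addA lp_addC lp_add0 lp_addN.

Let lp_scaleA a b x : lp_scale a (lp_scale b x) = lp_scale (a * b) x.
Proof. by apply: lp_sumP => i /=; rewrite scalerA. Qed.
Let lp_scale1 : left_id 1 lp_scale.
Proof. by move=> x; apply: lp_sumP => i /=; rewrite scale1r. Qed.
Let lp_scaleDr : right_distributive lp_scale +%R.
Proof. by move=> a x y; apply: lp_sumP => i /=; rewrite scalerDr. Qed.
Let lp_scaleDl x : {morph lp_scale^~ x : a b / a + b}.
Proof. by move=> a b; apply: lp_sumP => i /=; rewrite scalerDl. Qed.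

HB.instance Definition _ := GRing.Zmodule_isLmodule.Build R lp
  lp_scaleA lp_scale1 lp_scaleDr lp_scaleDl.

Let lp_normD x y : lp_norm (x + y) <= lp_norm x + lp_norm y.
Proof.
apply/ler_addgt0Pl => e e0; have e20 : 0 < e / 2 by rewrite divr_gt0.
have leN (z : lp) : (esump z <= ((lp_norm z + e / 2) `^ p)%:E)%E.
  rewrite /esump -lp_normX lee_fin ge0_ler_powR ?(ltW p0) ?nnegrE//.
    by rewrite addr_ge0// ltW.
  by rewrite lerDl ltW.
have N0 z : 0 < lp_norm z + e / 2 by rewrite ltr_wpDl.
have := esumpD (N0 x) (N0 y) (leN x) (leN y).
rewrite -[X in (X <= _)%E](lp_normX (x + y)) lee_fin addrACA -splitr addrC.
move: (lp_norm_ge0 (x + y)) (addr_ge0 (lp_norm_ge0 x) (lp_norm_ge0 y)).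
move: (lp_norm (x + y)) (lp_norm x + lp_norm y) => u v u0 v0 uv.
have ev0 : 0 <= e + v by rewrite addr_ge0// ltW.
rewrite leNgt; apply/negP => lt.
by move: uv; rewrite leNgt gt0_ltr_powR.
Qed.

Let lp_normZ a x : lp_norm (a *: x) = `|a| * lp_norm x.
Proof.
apply: (powR_injective p0); rewrite ?nnegrE ?mulr_ge0//.
apply: EFin_inj; rewrite lp_normX powRM// EFinM lp_normX.
exact: esumpZ.
Qed.

Let lp_norm0_eq0 x : lp_norm x = 0 -> x = 0.
Proof.
move=> x0; apply: lp_sumP => i; apply/normr0_eq0.
apply: (@powR_eq0_eq0 _ _ p); apply/eqP; rewrite eq_le powR_ge0 andbT.
rewrite -lee_fin -[leRHS](_ : (lp_norm x `^ p)%:E = _); last first.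
  by rewrite x0 powR0// gt_eqF.
rewrite lp_normX; apply: esum_ge; exists [set i].
  by split => //; exact: finite_set1.
by rewrite fsbig_set1.
Qed.

HB.instance Definition _ := Lmodule_isNormed.Build R lp
  lp_normD lp_normZ lp_norm0_eq0.

Lemma lp_sum_normE (x : lp) :
  `|x| = fine (\esum_(i in [set: I]) (`|x i| `^ p)%:E)%E `^ p^-1.
Proof. by []. Qed.

Lemma lp_addE (x y : lp) i : (x + y) i = x i + y i. Proof. by []. Qed.
Lemma lp_scaleE a (x : lp) i : (a *: x) i = a *: x i. Proof. by []. Qed.

End lp_sum_theory.

(* The sequence space l_p is the l_p-sum of countably many copies of R. *)
Definition ell {R : realType} (p : R) (p1 : 1 <= p) : normedModType R :=
  lp_sum p1 (fun _ : nat => R^o).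

Lemma ell_normE {R : realType} (p : R) (p1 : 1 <= p)
    (x : lp_sum p1 (fun _ : nat => R^o)) :
  `|x : ell p1| = fine (\sum_(n <oo) (`|x n| `^ p)%:E)%E `^ p^-1.
Proof.
by rewrite nneseries_esumT// => n; rewrite lee_fin powR_ge0.
Qed.

(* Main.v *)
Require Import Defs.
From mathcomp Require Import all_boot all_order all_algebra.
From mathcomp Require Import all_classical all_reals all_analysis.
From mathcomp Require Import ring lra.

Import Order.TTheory GRing.Theory Num.Theory.
Import numFieldNormedType.Exports.

Set Implicit Arguments.
Unset Strict Implicit.
Unset Printing Implicit Defensive.

Local Open Scope classical_set_scope.
Local Open Scope ring_scope.

(* Suppose f : X -> Y is a coarse quotient mapping, X an l_p-sum of
   finite-dimensional spaces, and T embeds l_q in Y.  Call x in X a lift of z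
   in l_q when f x is within K of T z.  Moving z to z' can be followed by lifts
   at a cost c |z - z'| + B in X; let D be the infimum of the admissible rates
   c.  Coarse continuity makes f Lipschitz at large distances, so D > 0.

   Let t = |z - z'| be large, a = (z' - z) / 3, and travel from z to z' through
   z + a and the forking points z + 2 a + tau t e_n.  In l_q the detour costs
   only a factor 1 + O(tau^q), once the n-th coordinate of a is negligible.
   The lifts x, u, v_n of z, z + a, z + 2 a + tau t e_n have the v_n separated
   by a multiple of tau t, so property (beta), with modulus of power type p in
   X, makes some |x - v_n| shorter than the detour by a factor 1 - k tau^p.
   Since p < q, a small tau gains more than it loses, and the rate D could be
   improved. *)

(** * Power inequalities *)

Lemma le_of_powR (R : realType) (p a b : R) : 0 < p -> 0 <= a -> 0 <= b ->
  a `^ p <= b `^ p -> a <= b.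
Proof.
move=> p0 a0 b0; rewrite !leNgt; apply: contra => lt.
by rewrite gt0_ltr_powR// nnegrE.
Qed.

Lemma le_of_powRD (R : realType) (p a b c : R) : 0 < p -> 0 <= a -> 0 <= b ->
  a `^ p = b `^ p + c `^ p -> b <= a.
Proof.
move=> p0 a0 b0 abc; apply: (le_of_powR p0) => //.
by rewrite abc lerDl powR_ge0.
Qed.

(** Convexity of the p-th power at the midpoint of [a] and [b]. *)
Lemma powRD_le (R : realType) (p a b : R) : 1 <= p -> 0 <= a -> 0 <= b ->
  (a + b) `^ p <= 2 `^ (p - 1) * (a `^ p + b `^ p).
Proof.
move=> p1 a0 b0.
have p0 : 0 < p by exact: lt_le_trans p1.
have half0 : 0 <= 2^-1 :> R by rewrite invr_ge0.
have half1 : 2^-1 <= 1 :> R by rewrite invf_le1// ler1n.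
have := convex_powR p1 (Itv01 half0 half1).
move=> /(_ a b).
rewrite !inE/= !in_itv/= !andbT => /(_ a0 b0).
rewrite !convRE/=.
have -> : unstable.onem (2^-1) = 2^-1 :> R.
  by rewrite /unstable.onem {1}(splitr 1) div1r addrK.
set c := conv _ _ _.
have -> : c = 2^-1 * (a + b).
  rewrite /c [LHS]convRE/= -[unstable.onem _]/(1 - 2^-1); lra.
rewrite -mulrDr powRM ?addr_ge0// => H.
have h : 2 `^ p * 2^-1 `^ p = 1 :> R.
  by rewrite -powRM// divff// powR1.
have -> : 2 `^ (p - 1) = 2 `^ p * 2^-1 :> R.
  by rewrite powRD ?pnatr_eq0 ?implybT// powR_inv1.
rewrite -[leLHS]mul1r -[X in X * _ <= _]h -!mulrA.
by rewrite ler_wpM2l ?powR_ge0.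
Qed.

(** Young's inequality for the product of [a / b] and 1 linearizes the p-th root: (1 - h)^(1/p) <= 1
    - h/p. *)
Lemma le_of_powR_mul1B (R : realType) (p a b h : R) :
  1 < p -> 0 <= a -> 0 < b -> a `^ p <= b `^ p * (1 - h) ->
  a <= b * (1 - h / p).
Proof.
move=> p1 a0 b0 H.
have p0 : 0 < p by exact: lt_trans p1.
have bp : 0 < b `^ p by rewrite powR_gt0.
have q0 : 0 < (1 - p^-1)^-1 by rewrite invr_gt0 subr_gt0 invf_lt1.
have := @conjugate_powR _ (a / b) 1 p _ (divr_ge0 a0 (ltW b0)) ler01 p0 q0.
rewrite invrK addrC subrK => /(_ erefl).
rewrite powR1 mul1r mulr1 ler_pdivrMr// => /le_trans; apply.
rewrite mulrC ler_wpM2l// ?(ltW b0)//.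
have : (a / b) `^ p <= 1 - h.
  by rewrite powRM ?invr_ge0 ?(ltW b0)// -powR_inv1 ?(ltW b0)// powRAC
     powR_inv1 ?(ltW bp)// ler_pdivrMr// mulrC.
move=> /(ler_wpM2r (ltW (divr_gt0 ltr01 p0))); rewrite !div1r; lra.
Qed.

(** Since 1 + h <= (1 + h)^q, a q-th root costs at most the factor 1 + h. *)
Lemma le_of_powR_mul1D (R : realType) (q a b h : R) :
  1 <= q -> 0 <= a -> 0 <= b -> 0 <= h ->
  a `^ q <= b `^ q * (1 + h) -> a <= b * (1 + h).
Proof.
move=> q1 a0 b0 h0 H; have q0 : 0 < q by exact: lt_le_trans q1.
have h1 : 1 <= 1 + h by rewrite lerDl.
have h0' : 0 <= 1 + h by rewrite addr_ge0.
apply: (le_of_powR q0) => //; first exact: mulr_ge0.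
apply: (le_trans H); rewrite powRM// ler_wpM2l ?powR_ge0//.
by rewrite -{1}[1 + h]powRr1// ler_powR.
Qed.

Lemma powR_small (R : realType) (r e : R) : 0 < r -> 0 < e ->
  exists2 t, 0 < t & t `^ r <= e.
Proof.
move=> r0 e0; exists (e `^ r^-1); first by rewrite powR_gt0.
by rewrite -powRrM mulVf ?gt_eqF// powRr1// ltW.
Qed.

Lemma powR_1D_small (R : realType) (p e : R) : 0 < p -> 1 < e ->
  exists2 t, 0 < t & (1 + t) `^ p <= e.
Proof.
move=> p0 e1; have e0 : 0 < e by exact: lt_trans e1.
exists (e `^ p^-1 - 1); last first.
  by rewrite addrC subrK -powRrM mulVf ?gt_eqF// powRr1// ltW.
have <- : 1 `^ p^-1 = 1 :> R by rewrite powR1.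
by rewrite subr_gt0 gt0_ltr_powR ?invr_gt0// nnegrE ltW.
Qed.

(** * Bounded sets of finite-dimensional normed spaces *)

(* The color [c v] names the piece containing [v] in a finite cover of [A] by
   sets of diameter at most [e]. *)
Definition totally_bounded (R : realType) (V : normedModType R) (A : set V) :=
  forall e : R, 0 < e -> exists (C : finType) (c : V -> C),
    forall v w, A v -> A w -> c v = c w -> `|v - w| <= e.

(** The color is the index of the grid cell of length [e], counted from -M. *)
Lemma totally_bounded_itv (R : realType) (M : R) :
  totally_bounded [set x : R^o | `|x| <= M].
Proof.
move=> e e0; pose n (x : R) := Num.truncn ((x + M) / e).
pose N := Num.truncn ((M + M) / e).
exists 'I_N.+1, (fun x => inord (n x)) => v w /= /ler_normlP[v1 v2].
move=> /ler_normlP[w1 w2] /(congr1 val)/=.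
have nN x : x <= M -> (n x < N.+1)%N.
  by move=> xM; rewrite ltnS le_truncn// ler_pM2r ?invr_gt0// lerD2r.
rewrite !inordK ?nN// => nvw.
have nP x : - x <= M -> (n x)%:R * e <= x + M < (n x).+1%:R * e.
  move=> xM; rewrite -ler_pdivlMr// -ltr_pdivrMr//.
  by rewrite truncn_itv// divr_ge0 ?(ltW e0)// addrC -lerBlDl sub0r lerNl.
have := nP _ v1; have := nP _ w1; rewrite nvw -!natr1 !mulrDl !mul1r.
move=> /andP[? ?] /andP[? ?]; apply/ler_normlP; split; lra.
Qed.

Definition span_ord (R : realType) (V : normedModType R) n (e : 'I_n -> V) :
    set V :=
  [set v | exists c : 'I_n -> R, v = \sum_(i < n) c i *: e i].

Lemma span_ordZ (R : realType) (V : normedModType R) n (e : 'I_n -> V) a v :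
  span_ord e v -> span_ord e (a *: v).
Proof.
move=> [c ->]; exists (fun i => a * c i); rewrite scaler_sumr.
by apply: eq_bigr => i _; rewrite scalerA.
Qed.

Lemma span_ordD (R : realType) (V : normedModType R) n (e : 'I_n -> V) v w :
  span_ord e v -> span_ord e w -> span_ord e (v + w).
Proof.
move=> [c ->] [d ->]; exists (fun i => c i + d i); rewrite -big_split.
by apply: eq_bigr => i _; rewrite scalerDl.
Qed.

(** Induction on [n], splitting off the last vector; the vectors may be dependent. *)
Lemma totally_bounded_span (R : realType) (V : normedModType R) n
    (e : 'I_n -> V) (M : R) :
  totally_bounded [set v | `|v| <= M /\ span_ord e v].
Proof.
elim: n e M => [|n IH] e M.
  move=> d d0; exists unit, (fun=> tt) => v w [_ [c ->]] [_ [c' ->]] _.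
  by rewrite !big_ord0 subrr normr0 ltW.
pose f := e ord_max; pose e' i := e (widen_ord (leqnSn n) i).
have dec v : span_ord e v -> exists (c : R) w, span_ord e' w /\ v = w + c *: f.
  move=> [c ->]; rewrite big_ord_recr/=; exists (c ord_max).
  by exists (\sum_(i < n) c (widen_ord (leqnSn n) i) *: e' i); split => //;
    exists (fun i => c (widen_ord (leqnSn n) i)).
(* Either [f] is at positive distance from the span of the other vectors and
   its coefficient is bounded, or that span is dense in the whole span. *)
have [[d d0 fd]|near] := pselect (exists2 d : R, 0 < d &
    forall w, span_ord e' w -> d <= `|f - w|).
  (* [g v] picks a coefficient of [f] and a remainder; off the span it is a dummy value. *)
  have /choice[g gP] : forall v, exists cw : R * V, span_ord e v ->
      span_ord e' cw.2 /\ v = cw.2 + cw.1 *: f.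
    move=> v; have [/dec[c [w cw]]|?] := pselect (span_ord e v).
      by exists (c, w).
    by exists (0, 0).
  (* If the coefficient c is nonzero, v = c (f - w) with w in the smaller span, so |v| >= |c| d. *)
  have coef v : `|v| <= M -> span_ord e v -> `|(g v).1| <= M / d.
    move=> vM ev; have [ew vE] := gP v ev; rewrite ler_pdivlMr//.
    apply: le_trans vM; have [->|c0] := eqVneq (g v).1 0.
      by rewrite normr0 mul0r.
    have nE : v = (g v).1 *: (f - (- (g v).1^-1) *: (g v).2).
      by rewrite {1}vE scaleNr opprK scalerDr scalerA mulfV// scale1r addrC.
    by rewrite [in leRHS]nE normrZ ler_wpM2l// fd//; exact: span_ordZ.
  have rest v : `|v| <= M -> span_ord e v -> `|(g v).2| <= M + M / d * `|f|.
    move=> vM ev; have [ew vE] := gP v ev.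
    have -> : (g v).2 = v - (g v).1 *: f by rewrite {2}vE addrK.
    by rewrite (le_trans (ler_normB _ _))// lerD// normrZ ler_wpM2r// coef.
  move=> eps eps0; have f10 : 0 < `|f| + 1 by rewrite ltr_wpDl.
  have eps2 : 0 < eps / 2 by rewrite divr_gt0.
  have [C1 [c1 c1P]] := @totally_bounded_itv R (M / d) _
    (divr_gt0 eps2 f10).
  have [C2 [c2 c2P]] := IH e' (M + M / d * `|f|) _ eps2.
  exists (C1 * C2)%type, (fun v => (c1 (g v).1, c2 (g v).2)).
  move=> v w [vM ev] [wM ew] [/c1P h1 /c2P h2].
  have [ev2 vE] := gP v ev; have [ew2 wE] := gP w ew.
  have {h2} := h2 (conj (rest _ vM ev) ev2) (conj (rest _ wM ew) ew2).
  have {h1} := h1 (coef _ vM ev) (coef _ wM ew).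
  rewrite {3}vE {3}wE ler_pdivlMr// => h1 h2.
  have -> : (g v).2 + (g v).1 *: f - ((g w).2 + (g w).1 *: f) =
      ((g v).2 - (g w).2) + ((g v).1 - (g w).1) *: f.
    by rewrite scalerBl opprD addrACA.
  rewrite (le_trans (ler_normD _ _))// normrZ (splitr eps) lerD//.
  by apply: le_trans h1; rewrite ler_wpM2l// lerDl.
(* In the dense case, [f] is replaced by a vector of the smaller span at arbitrarily small cost. *)
have app (d : R) v : 0 < d -> span_ord e v ->
    exists2 w, span_ord e' w & `|v - w| <= d.
  move=> d0 /dec[c [w [ew ->]]].
  have c10 : 0 < `|c| + 1 by rewrite ltr_wpDl.
  have [w' ew' w'd] : exists2 w', span_ord e' w' & `|f - w'| <= d / (`|c| + 1).
    apply: contrapT => H; apply: near; exists (d / (`|c| + 1)).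
      by rewrite divr_gt0.
    move=> w' ew'; rewrite leNgt; apply/negP => /ltW lt.
    by apply: H; exists w'.
  exists (w + c *: w'); first by apply: span_ordD => //; exact: span_ordZ.
  have -> : w + c *: f - (w + c *: w') = c *: (f - w').
    by rewrite scalerBr opprD addrACA subrr add0r.
  rewrite normrZ; move: w'd; rewrite ler_pdivlMr// mulrC; apply: le_trans.
  by rewrite ler_wpM2r// lerDl.
move=> eps eps0; have eps3 : 0 < eps / 3 by rewrite divr_gt0.
have /choice[g gP] : forall v, exists w, span_ord e v ->
    span_ord e' w /\ `|v - w| <= eps / 3.
  move=> v; have [/(app _ _ eps3)[w ew vw]|?] := pselect (span_ord e v).
    by exists w.
  by exists 0.
have [C [c cP]] := IH e' (M + eps / 3) _ eps3.
exists C, (fun v => c (g v)) => v w [vM ev] [wM ew] /cP.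
have [egv vgv] := gP v ev; have [egw wgw] := gP w ew.
have bd u : `|u| <= M -> `|u - g u| <= eps / 3 -> `|g u| <= M + eps / 3.
  move=> uM uP; have -> : g u = u - (u - g u) by rewrite subKr.
  by rewrite (le_trans (ler_normB _ _))// lerD.
move=> /(_ (conj (bd v vM vgv) egv) (conj (bd w wM wgw) egw)) h.
have -> : v - w = (v - g v) + ((g v - g w) - (w - g w)).
  by rewrite opprB !subrKA.
have h3 := le_trans (ler_normB _ _) (lerD h wgw).
have h4 := le_trans (ler_normD _ _) (lerD vgv h3).
by apply: (le_trans h4); lra.
Qed.

Lemma finite_dimensional_totally_bounded (R : realType) (V : normedModType R)
    (M : R) :
  finite_dimensional V -> totally_bounded [set v : V | `|v| <= M].
Proof.
move=> [n [e eV]] eps eps0.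
have [C [c cP]] := @totally_bounded_span _ _ _ e M _ eps0.
by exists C, c => v w vM wM; apply: cP; split => //; exact: eV.
Qed.

(** * Restrictions in l_p-sums *)

Section restriction.
Context {R : realType} {p : R} {p1 : 1 <= p} {I : choiceType}.
Context {E : I -> normedModType R}.
Local Notation lp := (lp_sum p1 E).
Implicit Types (x y : lp) (A B : set I).

Let p0 : 0 < p. Proof. exact: lt_le_trans p1. Qed.

(** Families that are not summable are allowed: the unit vectors of l_q are cut out of a constant
    family. *)
Definition restr_fun A (x : forall i, E i) : forall i, E i :=
  fun i => if i \in A then x i else 0.

Lemma esum_restr A (x : forall i, E i) :
  (\esum_(i in [set: I]) (`|restr_fun A x i| `^ p)%:E =
   \esum_(i in A) (`|x i| `^ p)%:E)%E.
Proof.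
rewrite [RHS]esum_mkcond; apply: eq_esum => i _.
by rewrite /restr_fun; case: ifP => // _; rewrite normr0 powR0// gt_eqF.
Qed.

Lemma restr_summable A x :
  (\esum_(i in [set: I]) (`|restr_fun A x i| `^ p)%:E < +oo)%E.
Proof.
apply: le_lt_trans (lp_summable x); apply: le_esum => i _.
rewrite lee_fin ge0_ler_powR ?nnegrE ?(ltW p0)// /restr_fun.
by case: ifP; rewrite ?normr0.
Qed.

Definition restr A x : lp := LpSum p1 (restr_summable A x).

Lemma restrE A x i : restr A x i = if i \in A then x i else 0.
Proof. by []. Qed.

Lemma norm_restrX A x :
  ((`|restr A x| `^ p)%:E = \esum_(i in A) (`|x i| `^ p)%:E)%E.
Proof. by rewrite lp_normX esum_restr. Qed.

Lemma norm_restrID A x :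
  `|x| `^ p = `|restr A x| `^ p + `|restr (~` A) x| `^ p.
Proof.
apply: EFin_inj; apply: (etrans (lp_normX x)); rewrite (esumID A); last first.
  by move=> i _; rewrite lee_fin powR_ge0.
rewrite EFinD; congr (_ + _)%E; rewrite setTI;
  apply: esym; exact: norm_restrX.
Qed.

Lemma restrD A x y : restr A (x + y) = restr A x + restr A y.
Proof.
by apply: lp_sumP => i; rewrite lp_addE !restrE; case: ifP; rewrite ?addr0.
Qed.

Lemma restrZ A a x : restr A (a *: x) = a *: restr A x.
Proof.
by apply: lp_sumP => i; rewrite lp_scaleE !restrE; case: ifP; rewrite ?scaler0.
Qed.

Lemma restrB A x y : restr A (x - y) = restr A x - restr A y.
Proof. by rewrite -(scaleN1r y) restrD restrZ scaleN1r. Qed.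

Lemma le_norm_restr A x : `|restr A x| <= `|x|.
Proof.
exact: (le_of_powRD p0 (normr_ge0 _) (normr_ge0 _) (norm_restrID A x)).
Qed.

Lemma norm_restr1 i x : `|restr [set i] x| = `|x i|.
Proof.
apply: (powR_injective p0); rewrite ?nnegrE//; apply: EFin_inj.
by rewrite norm_restrX esum_set1// lee_fin powR_ge0.
Qed.

Lemma le_norm_coord i x : `|x i| <= `|x|.
Proof. by rewrite -norm_restr1 le_norm_restr. Qed.

Lemma norm_restrU A B x :
  `|restr (A `|` B) x| <= `|restr A x| + `|restr B x|.
Proof.
have -> : restr (A `|` B) x = restr A x + restr (~` A) (restr B x).
  apply: lp_sumP => i; rewrite lp_addE !restrE in_setU in_setC.
  by case: (i \in A) (i \in B) => [] []; rewrite ?addr0 ?add0r.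
apply: (le_trans (ler_normD _ _)); apply: lerD; first exact: lexx.
exact: le_norm_restr.
Qed.

(** The p-th power of the norm is a supremum of finite partial sums; a sum within e^p of it leaves
    at most e^p outside. *)
Lemma restr_tail x (e : R) : 0 < e ->
  exists s : seq I, `|restr (~` [set` s]) x| <= e.
Proof.
move=> e0; have ep : 0 < e `^ p by rewrite powR_gt0.
have : ((`|x| `^ p - e `^ p)%:E < (`|x| `^ p)%:E)%E.
  by rewrite lte_fin ltrBlDr ltrDl.
rewrite [ltRHS]lp_normX => /ereal_sup_gt[_ [A [finA _] <-]].
rewrite -esum_fset//.
rewrite -norm_restrX lte_fin => lt.
have /finite_seqP[s As] := finA; exists s; rewrite -As.
apply: (le_of_powR p0); [exact: normr_ge0|exact: ltW|].
suff le_tail (a b c d : R) : a = b + c -> a - d < b -> c <= d.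
  exact: (le_tail _ _ _ _ (norm_restrID A x) lt).
by move=> ->; rewrite ltrBlDr ltrD2l => /ltW.
Qed.

(** Product of the colorings of the finitely many coordinates in [s]. This is where the finite
    dimension of the summands enters. *)
Lemma restr_coloring (s : seq I) (M e : R) :
  (forall i, finite_dimensional (E i)) -> 0 < e ->
  exists (C : finType) (c : lp -> C), forall x y,
    `|x| <= M -> `|y| <= M -> c x = c y -> `|restr [set` s] (x - y)| <= e.
Proof.
move=> fdE; elim: s e => [|i s IH] e e0.
  exists unit, (fun=> tt) => x y _ _ _.
  have -> : restr [set` [::]] (x - y) = 0.
    by apply: lp_sumP => i; rewrite restrE memNset.
  by rewrite normr0 ltW.
have e2 : 0 < e / 2 by rewrite divr_gt0.
have [C1 [c1 c1P]] := @finite_dimensional_totally_bounded R _ M (fdE i) _ e2.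
have [C2 [c2 c2P]] := IH _ e2.
exists (C1 * C2)%type, (fun x => (c1 (x i), c2 x)) => x y xM yM [h1 h2].
have {}h1 := c1P _ _ (le_trans (le_norm_coord i x) xM)
  (le_trans (le_norm_coord i y) yM) h1.
have {}h2 := c2P _ _ xM yM h2.
have -> : [set` i :: s] = [set i] `|` [set` s].
  by apply/seteqP; split => j /=; rewrite inE => /predU1P.
apply: (le_trans (norm_restrU _ _ _)); rewrite (splitr e).
apply: lerD; last exact: h2.
by apply: le_trans h1; rewrite norm_restr1.
Qed.

End restriction.

(** * Property (beta) *)

Section beta_estimate.
Context {R : realType} {p : R} (p_gt1 : 1 < p).

(** Half the excess of 2^(p-1) over 1, times 3^-p because only a third of the separation is
    recovered off a finite set. *)
Definition beta_const : R := (2 `^ (p - 1) - 1) / 2 * 3^-1 `^ p.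

Lemma gt1_pow2 : 1 < 2 `^ (p - 1) :> R.
Proof.
have e1 : 1 `^ (p - 1) = 1 :> R by rewrite powR1.
by rewrite -[ltLHS]e1 gt0_ltr_powR ?subr_gt0// ?nnegrE// ltr1n.
Qed.

Lemma beta_const_gt0 : 0 < beta_const.
Proof.
by rewrite mulr_gt0// ?powR_gt0 ?invr_gt0// divr_gt0// subr_gt0 gt1_pow2.
Qed.

(** [A], [b] are the norms of v_m - u on and off a finite set, [X], [Y] those of x - v_m. With k =
    2^(p-1), X^p <= k (r^p + A^p) and Y^p <= (k+1)/2 b^p. As A^p <= r^p - b^p, the sum is at most 2k
    r^p - (k-1)/2 b^p. *)
Lemma beta_estimate (r s t A b X Y : R) :
  0 <= r -> 0 < s -> 0 <= A -> 0 <= X -> 0 <= Y ->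
  0 < t -> (1 + t) `^ p <= (2 `^ (p - 1) + 1) / 2 ->
  s / 3 <= b -> A `^ p + b `^ p <= r `^ p ->
  X <= r + A -> Y <= t * (s / 3) + b ->
  X `^ p + Y `^ p <= (2 * r) `^ p - beta_const * s `^ p.
Proof.
move=> r0 s0 A0 X0 Y0 t0 tP sb Ab Xr Yb.
have p1 := ltW p_gt1; have p0 : 0 <= p by apply: le_trans p1.
have b0 : 0 <= b by apply: le_trans sb; rewrite divr_ge0// ltW.
have hX : X `^ p <= 2 `^ (p - 1) * (r `^ p + A `^ p).
  apply: le_trans (powRD_le p1 r0 A0).
  by rewrite ge0_ler_powR// nnegrE addr_ge0.
have hY : Y `^ p <= (2 `^ (p - 1) + 1) / 2 * b `^ p.
  apply: (@le_trans _ _ (((1 + t) * b) `^ p)).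
    rewrite ge0_ler_powR ?nnegrE ?mulr_ge0 ?addr_ge0 ?(ltW t0)//.
    apply: (le_trans Yb); rewrite mulrDl mul1r addrC lerD2l.
    by rewrite ler_wpM2l// ltW.
  by rewrite powRM ?addr_ge0 ?(ltW t0)// ler_wpM2r ?powR_ge0.
have h2 : 2 `^ p = 2 `^ (p - 1) * 2 :> R.
  by rewrite -{3}(powRr1 (ler0n R 2)) -powRD ?subrK// pnatr_eq0 implybT.
have hb : 3^-1 `^ p * s `^ p <= b `^ p.
  rewrite -powRM ?invr_ge0 ?(ltW s0)// mulrC ge0_ler_powR ?nnegrE//.
  by rewrite divr_ge0// ltW.
rewrite powRM// h2 /beta_const.
have := gt1_pow2; set k := 2 `^ (p - 1) in hX hY h2 *; move=> k1.
rewrite -mulrA.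
have h3 : (k - 1) / 2 * (3^-1 `^ p * s `^ p) <= (k - 1) / 2 * b `^ p.
  by rewrite ler_wpM2l// divr_ge0// subr_ge0 ltW.
have h4 : k * (A `^ p + b `^ p) <= k * r `^ p.
  by rewrite ler_wpM2l// (le_trans _ (ltW k1)).
lra.
Qed.

End beta_estimate.

Lemma pigeonhole_nat (C : finType) (c : nat -> C) :
  exists n k, n != k /\ c n = c k.
Proof.
pose f (i : 'I_#|C|.+1) := c i.
have : ~~ injectiveb f.
  apply/negP => /injectiveP/leq_card; rewrite card_ord ltnn//.
by move=> /injectivePn[i [j ij fij]]; exists (val i), (val j); split.
Qed.

Lemma third_dichotomy (R : realType) (s a b c : R) :
  c <= s / 3 -> s <= c + (a + b) -> s / 3 <= a \/ s / 3 <= b.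
Proof. by have [|] := leP (s / 3) a; [left|right; lra]. Qed.

(* Property (beta) of Rolewicz, with a modulus of power type [p]. *)
Definition beta_power_type (R : realType) (p k : R) (X : normedModType R) :=
  forall (x u : X) (v : nat -> X) (r s : R),
    0 < s -> `|x - u| <= r -> (forall n, `|v n - u| <= r) ->
    (forall n k, n != k -> s <= `|v n - v k|) ->
    exists n, `|x - v n| `^ p <= (2 * r) `^ p - k * s `^ p.

Section beta.
Context {R : realType} {p : R} {p1 : 1 <= p} {I : choiceType}.
Context {E : I -> normedModType R} (p_gt1 : 1 < p).
Context (fdE : forall i, finite_dimensional (E i)).
Local Notation lp := (lp_sum p1 E).

(** Outside a finite set [F], x - u is negligible. Two of the v_n - u nearly agree on [F], so one of
    them has a large part outside [F], which x - u can hardly add to. *)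
Lemma lp_sum_beta : beta_power_type p (beta_const (p := p)) lp.
Proof.
move=> x u v r s s0 xr vr sep.
have p0 : 0 < p by exact: lt_trans p_gt1.
have r0 : 0 <= r by exact: le_trans (normr_ge0 _) xr.
have [t t0 tP] : exists2 t, 0 < t & (1 + t) `^ p <= (2 `^ (p - 1) + 1) / 2.
  by apply: powR_1D_small => //; have := gt1_pow2 p_gt1; lra.
have s3 : 0 < s / 3 by rewrite divr_gt0.
have [F tailF] := restr_tail (x - u) (mulr_gt0 t0 s3).
set A := [set` F] in tailF.
have [C [c cP]] := @restr_coloring _ _ p1 _ E F r _ fdE s3.
have [n [k [nk cnk]]] := pigeonhole_nat (fun n => c (v n - u)).
(* Equal colors leave at most s/3 of the separation on [F]; one of the two tails takes another
   third. *)
have big : exists m, s / 3 <= `|restr (~` A) (v m - u)|.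
  have close := cP _ _ (vr n) (vr k) cnk.
  have sepnk := sep _ _ nk.
  have split3 : `|v n - v k| <= `|restr A ((v n - u) - (v k - u))| +
      (`|restr (~` A) (v n - u)| + `|restr (~` A) (v k - u)|).
    have vnk : v n - v k = (v n - u) - (v k - u) by rewrite opprB subrKA.
    rewrite [X in `|X| <= _]vnk.
    have := norm_restrU A (~` A) ((v n - u) - (v k - u)).
    rewrite setUv.
    have -> : restr setT (v n - u - (v k - u)) = v n - u - (v k - u).
      by apply: lp_sumP => i; rewrite restrE in_setT.
    move=> /le_trans; apply; apply: lerD; first exact: lexx.
    rewrite restrB; exact: ler_normB.
  have [le_n|le_k] := third_dichotomy close (le_trans sepnk split3).
    by exists n; exact: le_n.
  by exists k; exact: le_k.
have [m mbig] := big; exists m.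
have xv : x - v m = (x - u) - (v m - u) by rewrite opprB subrKA.
apply: (@le_trans _ _ (`|restr A (x - v m)| `^ p +
    `|restr (~` A) (x - v m)| `^ p)).
  by rewrite le_eqVlt; apply/orP; left; apply/eqP; exact: norm_restrID.
apply: (beta_estimate p_gt1 r0 s0 (normr_ge0 _) (normr_ge0 _) (normr_ge0 _)
  t0 tP mbig).
- apply: (@le_trans _ _ (`|v m - u| `^ p)).
    rewrite le_eqVlt; apply/orP; left; apply/eqP; apply: esym.
    exact: norm_restrID.
  apply: ge0_ler_powR; [exact: ltW|exact: normr_ge0|exact: r0|exact: vr].
- rewrite [X in restr A X]xv restrB; apply: (le_trans (ler_normB _ _)).
  apply: lerD; last exact: lexx.
  exact: le_trans (le_norm_restr _ _) xr.
- rewrite [X in restr _ X]xv restrB; apply: (le_trans (ler_normB _ _)).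
  by apply: lerD; [exact: tailF|exact: lexx].
Qed.

End beta.

(** * Forks in l_q *)

(** With a third of the way equal to [a], the vectors a + d n and a - d n are the legs into and out
    of the n-th forking point. *)
Definition has_forks (R : realType) (q : R) (Z : normedModType R) :=
  forall (a : Z) (tau t : R), 0 < tau -> 0 < t -> `|a| <= t / 3 ->
  exists d : nat -> Z,
    [/\ forall n, `|a + d n| <= t / 3 * (1 + (6 * tau) `^ q),
        forall n, `|a - d n| <= t / 3 * (1 + (6 * tau) `^ q) &
        forall n k, n != k -> tau * t <= `|d n - d k|].

Section ell_forks.
Context {R : realType} {q : R} {q1 : 1 <= q}.
Local Notation Z := (lp_sum q1 (fun _ : nat => R^o)).

Let q0 : 0 < q. Proof. exact: lt_le_trans q1. Qed.

Lemma ell_delta_summable n :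
  (\esum_(i in [set: nat])
     (`|restr_fun [set n] (fun=> 1 : R^o) i| `^ q)%:E < +oo)%E.
Proof.
by rewrite (@esum_restr _ _ q1 _ (fun=> R^o)) esum_set1 ?ltry.
Qed.

Definition ell_delta n : Z := LpSum q1 (ell_delta_summable n).

Lemma ell_deltaE n i : ell_delta n i = (i == n)%:R.
Proof.
rewrite /ell_delta/= /restr_fun; have [->|ne] := eqVneq i n.
  by rewrite mem_set.
by rewrite memNset//= => /eqP; rewrite (negPf ne).
Qed.

(** Only the n-th coordinate changes, and it stays below 2s; the others contribute at most |a|^q. *)
Lemma norm_ell_bump (a : Z) n (b s : R) : `|a n| <= s -> `|b| <= s ->
  `|a + b *: ell_delta n| `^ q <= `|a| `^ q + (2 * s) `^ q.
Proof.
move=> an bs.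
have comb (w u v A S : R) : w = u + v -> v <= A -> u <= S -> w <= A + S.
  by move=> -> ? ?; rewrite addrC lerD.
have tail : restr (~` [set n]) (a + b *: ell_delta n) = restr (~` [set n]) a.
  apply: lp_sumP => i; rewrite !restrE in_setC; case: ifP => // /negP ne.
  rewrite lp_addE lp_scaleE ell_deltaE; have [ein|_] := eqVneq i n.
    by exfalso; apply: ne; rewrite ein mem_set.
  by rewrite scaler0 addr0.
have head : `|restr [set n] (a + b *: ell_delta n)| <= 2 * s.
  rewrite norm_restr1 lp_addE lp_scaleE ell_deltaE eqxx.
  apply: (le_trans (ler_normD _ _)); rewrite mulr2n mulrDl mul1r.
  by apply: lerD; [exact: an|rewrite normrZ normr1 mulr1].
have := norm_restrID [set n] (a + b *: ell_delta n).
rewrite tail => nE.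
apply: (comb _ _ _ _ _ nE).
  apply: ge0_ler_powR; [exact: ltW|exact: normr_ge0|exact: normr_ge0|].
  exact: le_norm_restr.
apply: ge0_ler_powR; [exact: ltW|exact: normr_ge0| |exact: head].
exact: le_trans (normr_ge0 _) head.
Qed.

Lemma ell_coord_small (a : Z) (s : R) : 0 < s ->
  exists N, forall n, (N <= n)%N -> `|a n| <= s.
Proof.
move=> s0; have [F Fs] := restr_tail a s0.
(* The successors put every index of [F] strictly below the bound. *)
exists (\max_(i <- F) i.+1)%N => n Fn.
have nF : n \notin F.
  apply/negP => nF; have : (n < \max_(i <- F) i.+1)%N by exact: leq_bigmax_seq.
  by rewrite ltnNge Fn.
have -> : a n = restr (~` [set` F]) a n.
  by rewrite restrE mem_set// => /= nF'; rewrite nF' in nF.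
apply: le_trans Fs; exact: le_norm_coord.
Qed.

(** Bumps of height tau t are placed where the coordinates of [a] are at most tau t; they add at
    most (2 tau t)^q = (t/3)^q (6 tau)^q to the q-th power of the norm. *)
Lemma ell_has_forks : has_forks q (ell q1).
Proof.
move=> a tau t tau0 t0 at3.
have s0 : 0 < tau * t by rewrite mulr_gt0.
have t30 : 0 <= t / 3 by rewrite divr_ge0// ltW.
have [N NP] := ell_coord_small a s0.
have bump n b : (N <= n)%N -> `|b| <= tau * t ->
    `|(a : Z) + b *: ell_delta n| <= t / 3 * (1 + (6 * tau) `^ q).
  move=> Nn bs.
  apply: (le_of_powR_mul1D q1 (normr_ge0 _) t30 (powR_ge0 _ _)).
  apply: (le_trans (norm_ell_bump (NP n Nn) bs)).
  rewrite mulrDr mulr1; apply: lerD.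
    by apply: ge0_ler_powR; [exact: ltW|exact: normr_ge0|exact: t30|exact: at3].
  rewrite -powRM// ?mulr_ge0 ?(ltW tau0)//.
  have -> : t / 3 * (6 * tau) = 2 * (tau * t) by field.
  exact: lexx.
exists (fun n => (tau * t) *: ell_delta (N + n)); split.
- by move=> n; apply: bump; rewrite ?leq_addr// gtr0_norm.
- move=> n; have := bump (N + n)%N (- (tau * t)).
  by rewrite scaleNr; apply; rewrite ?leq_addr// normrN gtr0_norm.
move=> n k nk; apply: le_trans (le_norm_coord (N + n)%N _).
rewrite -scaleN1r lp_addE !lp_scaleE !ell_deltaE eqxx eqn_add2l (negPf nk).
by rewrite !scaler0 addr0 normrZ normr1 mulr1 ler_norm.
Qed.

End ell_forks.

(** * The fork argument *)

(** The detour loses h = (6 tau)^q and property (beta) gains m of order tau^p, so 4h <= m for small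
    tau. Then d + r <= 3r (1 - m) <= ct (1 + 2h)(1 - m) <= ct (1 - m/2). Neither tau nor mu depends
    on c or B. *)
Lemma fork_numerics (R : realType) (p q K L k0 : R) :
  1 < p -> p < q -> 0 < K -> 0 < L -> 0 < k0 ->
  exists tau mu : R, [/\ 0 < tau, 0 < mu &
    forall c B, 0 < c -> c <= K -> 0 <= B -> exists2 t0, 0 < t0 &
      forall t r s, t0 <= t ->
        r = c * (t / 3 * (1 + (6 * tau) `^ q)) + B -> s = tau * t / (2 * L) ->
        1 <= s /\
        forall d, 0 <= d -> d `^ p <= (2 * r) `^ p - k0 * s `^ p ->
          d + r <= c * (1 - mu) * t].
Proof.
move=> p1 pq K0 L0 k00; have p0 : 0 < p by exact: lt_trans p1.
have q0 : 0 < q by exact: lt_trans pq.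
have qp0 : 0 < q - p by rewrite subr_gt0.
(* Chosen so that s / (2r) >= l tau, from s = tau t / (2L) and 2r <= (4/3) K t. *)
pose l := 3 / (8 * (L * K)).
have l0 : 0 < l by rewrite divr_gt0// !mulr_gt0.
(* Makes 2 (k0 / p) (l tau)^p equal to 3m, where m = k tau^p. *)
pose k := 2 * k0 * l `^ p / (3 * p).
have k_gt0 : 0 < k by rewrite divr_gt0 ?mulr_gt0 ?powR_gt0.
have s6 : 0 < 6 `^ q :> R by rewrite powR_gt0.
(* [t1] will give 2h <= m/2, and [t2] will give h <= 1/2. *)
have [t1 t10 t1P] := powR_small qp0
  (divr_gt0 k_gt0 (mulr_gt0 (ltr0n R 4) s6)).
have [t2 t20 t2P] := powR_small q0
  (divr_gt0 ltr01 (mulr_gt0 (ltr0n R 2) s6)).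
pose tau := Num.min t1 t2.
have tau0 : 0 < tau by rewrite lt_min t10 t20.
have tau1 : tau `^ (q - p) <= k / (4 * 6 `^ q).
  apply: le_trans t1P; rewrite ge0_ler_powR ?nnegrE ?(ltW tau0) ?(ltW t10)//.
    exact: ltW.
  by rewrite ge_min lexx.
have tau2 : tau `^ q <= 1 / (2 * 6 `^ q).
  apply: le_trans t2P; rewrite ge0_ler_powR ?nnegrE ?(ltW tau0) ?(ltW t20)//.
    exact: ltW.
  by rewrite ge_min lexx orbT.
pose h := (6 * tau) `^ q.
have h0 : 0 < h by rewrite powR_gt0 ?mulr_gt0.
have hE : h = 6 `^ q * tau `^ q by rewrite /h powRM// ltW.
have h12 : h <= 1 / 2.
  rewrite hE; apply: le_trans (ler_wpM2l (ltW s6) tau2) _.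
  rewrite le_eqVlt; apply/orP; left; apply/eqP; field.
  by rewrite lt0r_neq0.
pose m := k * tau `^ p.
have m0 : 0 < m by rewrite mulr_gt0// powR_gt0.
have hm : 2 * h <= m / 2.
  have -> : h = 6 `^ q * (tau `^ (q - p) * tau `^ p).
    by rewrite hE -powRD ?subrK// (gt_eqF tau0) implybT.
  have := ler_wpM2r (powR_ge0 tau p) tau1.
  move=> /(ler_wpM2l (ltW s6))/le_trans/(_ (lexx _)).
  have -> : 6 `^ q * (k / (4 * 6 `^ q) * tau `^ p) = m / 4.
    by rewrite /m; field; rewrite lt0r_neq0.
  lra.
exists tau, (m / 2); split => //; first by rewrite divr_gt0.
move=> c B c0 cK B0.
(* The first bound forces s >= 1; the second absorbs [B] into c (t/3) h. *)
exists (Num.max (2 * L / tau) (3 * B / (c * h))).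
  by rewrite lt_max (divr_gt0 (mulr_gt0 (ltr0n R 2) L0) tau0).
move=> t r s; rewrite ge_max => /andP[tL tB] rE sE.
have t0 : 0 < t by apply: lt_le_trans tL; rewrite divr_gt0 ?mulr_gt0.
have s1 : 1 <= s.
  rewrite sE ler_pdivlMr ?mulr_gt0// mul1r.
  by move: tL; rewrite ler_pdivrMr// (mulrC t).
split=> // d d0 dP; have s0 : 0 < s by exact: lt_le_trans s1.
have Bh : B <= c * (t / 3) * h.
  by move: tB; rewrite ler_pdivrMr ?mulr_gt0//; lra.
have r_le : r <= c * (t / 3) * (1 + 2 * h) by rewrite rE -/h; lra.
have ct0 : 0 < c * (t / 3) by rewrite mulr_gt0// divr_gt0.
have r0 : 0 < r.
  by rewrite rE ltr_wpDr// mulr_gt0// mulr_gt0 ?divr_gt0// addr_gt0.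
have r_le2 : 2 * r <= 4 / 3 * (K * t).
  have h1 : c * (t / 3) * (1 + 2 * h) <= c * (t / 3) * 2.
    by rewrite ler_wpM2l ?(ltW ct0)//; lra.
  have h2 : c * t <= K * t by rewrite ler_wpM2r// ltW.
  lra.
have ratio : l * tau <= s / (2 * r).
  rewrite ler_pdivlMr ?mulr_gt0//.
  apply: le_trans (ler_wpM2l (ltW (mulr_gt0 l0 tau0)) r_le2) _.
  rewrite sE /l le_eqVlt; apply/orP; left; apply/eqP; field.
  by rewrite !lt0r_neq0.
have ratioX : l `^ p * tau `^ p <= (s / (2 * r)) `^ p.
  rewrite -powRM ?(ltW l0) ?(ltW tau0)// ge0_ler_powR ?(ltW p0) ?nnegrE//.
    by rewrite mulr_ge0 ?(ltW l0) ?(ltW tau0).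
  by rewrite divr_ge0 ?mulr_ge0 ?(ltW s0) ?(ltW r0).
have r20 : 0 < 2 * r by rewrite mulr_gt0.
have dle : d <= 2 * r * (1 - k0 * (s / (2 * r)) `^ p / p).
  apply: le_of_powR_mul1B => //; apply: (le_trans dP).
  rewrite mulrBr mulr1 lerB// mulrCA ler_wpM2l ?(ltW k00)//.
  rewrite -powRM ?(ltW r20) ?divr_ge0 ?(ltW s0) ?(ltW r20)//.
  by rewrite mulrC divfK// lt0r_neq0.
have X_ge : 3 * m <= 2 * (k0 * (s / (2 * r)) `^ p / p).
  have := ler_wpM2l (ltW (divr_gt0 (mulr_gt0 (ltr0n R 2) k00) p0)) ratioX.
  have -> : 2 * k0 / p * (l `^ p * tau `^ p) = 3 * m.
    by rewrite /m /k; field; rewrite lt0r_neq0.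
  by have -> : 2 * (k0 * (s / (2 * r)) `^ p / p) =
     2 * k0 / p * (s / (2 * r)) `^ p by ring.
set X := k0 * _ / p in dle X_ge.
have rX : r * (3 * m) <= r * (2 * X) by rewrite ler_wpM2l// ltW.
(* Since d >= 0 forces X <= 1, 3m <= 2X gives m <= 2/3. *)
have m1 : 0 <= 1 - m.
  have : 0 <= 2 * r * (1 - X) by exact: le_trans dle.
  rewrite pmulr_rge0// => ?; lra.
have : d + r <= 3 * (r * (1 - m)) by lra.
move=> /le_trans; apply.
have := ler_wpM2r m1 r_le => /(ler_wpM2l (ler0n R 3))/le_trans; apply.
have -> : 3 * (c * (t / 3) * (1 + 2 * h) * (1 - m)) =
  c * t * ((1 + 2 * h) * (1 - m)) by field.
have -> : c * (1 - m / 2) * t = c * t * (1 - m / 2) by ring.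
rewrite ler_wpM2l ?mulr_ge0 ?(ltW c0) ?(ltW t0)//.
have : 0 <= h * m by rewrite mulr_ge0 ?(ltW h0) ?(ltW m0).
lra.
Qed.

Definition lifts (R : realType) (X Z : normedModType R) (P : X -> Z -> Prop)
    (c B : R) :=
  forall x z z', P x z ->
    exists2 x', P x' z' & `|x - x'| <= c * `|z - z'| + B.

Section fork_argument.
Context {R : realType} {X Z : normedModType R} {P : X -> Z -> Prop}.
Context {p q L k0 : R} (p1 : 1 < p) (pq : p < q) (L0 : 0 < L) (k00 : 0 < k0).
Context (betaX : beta_power_type p k0 X) (forkZ : has_forks q Z).
Context (lipP : forall x z x' z', P x z -> P x' z' ->
  `|z - z'| <= L * (`|x - x'| + 1)).

(** If cL < 1, lifting a move of large length t contradicts t <= L (ct + B + 1). *)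
Lemma lifts_ge (c B : R) :
  (exists x z, P x z) -> lifts P c B -> L^-1 <= c.
Proof.
move=> [x [z Pxz]] lc.
(* Forks at 0 supply a nonzero vector [w] along which to move. *)
have [d [_ _ dsep]] := forkZ (a := 0) (tau := 1) (t := 1) ltr01 ltr01
  ltac:(by rewrite normr0 divr_ge0).
have {dsep} := dsep 0%N 1%N isT; rewrite mulr1; set w := d 0%N - d 1%N => w1.
have w0 : 0 < `|w| by exact: lt_le_trans w1.
rewrite leNgt; apply/negP => cL.
have {cL} : 0 < 1 - c * L by move: cL; rewrite -div1r ltr_pdivlMr// subr_gt0.
set e := 1 - c * L => e0.
pose t := (L * (`|B| + 1) + 1) / e.
have t0 : 0 < t by rewrite divr_gt0// ltr_wpDl// mulr_ge0 ?(ltW L0)// addr_ge0.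
have [x' Px' xx'] := lc x z (z + (t / `|w|) *: w) Pxz.
have := lipP Pxz Px'; move: xx'.
have -> : `|z - (z + (t / `|w|) *: w)| = t.
  rewrite opprD addNKr normrN normrZ normf_div normr_id divfK ?gt_eqF//.
  by rewrite gtr0_norm.
move=> h1 h2.
have {h2} h2 : t <= L * (c * t + B + 1).
  by apply: (le_trans h2); rewrite ler_wpM2l ?(ltW L0)// lerD2r.
have h3 : t * e = L * (`|B| + 1) + 1 by rewrite /t divfK// gt_eqF.
have : L * B <= L * `|B| by rewrite ler_wpM2l ?(ltW L0)// ler_norm.
by move: h3; rewrite /e; lra.
Qed.

(** Long moves pass through a well-chosen fork. One [mu] serves all rates up to [K], so that rates
    near the infimum can be improved. *)
Lemma lifts_contract (K : R) : 0 < K -> exists2 mu : R, 0 < mu &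
  forall c B, 0 < c -> c <= K -> 0 <= B -> lifts P c B ->
  exists B', lifts P (c * (1 - mu)) B'.
Proof.
move=> K0; have [tau [mu [tau0 mu0 H]]] := fork_numerics p1 pq K0 L0 k00.
exists mu => // c B c0 cK B0 lc; have [t0 t00 Ht] := H c B c0 cK B0.
(* The extra term c mu t0 pays for moves shorter than [t0], which are lifted directly. *)
exists (c * mu * t0 + B) => x z z' Pxz.
set t := `|z - z'|.
have [tt0|t0t] := ltP t t0.
  have [x' Px' xx'] := lc x z z' Pxz; exists x' => //.
  apply: (le_trans xx'); rewrite -/t.
  have : c * mu * t <= c * mu * t0.
    by rewrite ler_wpM2l ?mulr_ge0 ?(ltW c0) ?(ltW mu0)// ltW.
  lra.
have t_gt0 : 0 < t by exact: lt_le_trans t0t.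
pose a := 3^-1 *: (z' - z).
have na : `|a| = t / 3.
  by rewrite normrZ gtr0_norm ?invr_gt0// mulrC distrC.
have na_le : `|a| <= t / 3 by rewrite na.
have [d [dP dN dsep]] := forkZ tau0 t_gt0 na_le.
set h := (6 * tau) `^ q in dP dN Ht.
have h0 : 0 <= h by exact: powR_ge0.
pose r := c * (t / 3 * (1 + h)) + B.
pose s := tau * t / (2 * L).
have le_r w : w <= t / 3 * (1 + h) -> c * w + B <= r.
  by move=> wr; rewrite lerD2r ler_wpM2l// ltW.
have [u Pu xu] := lc x z (z + a) Pxz.
have {xu} xu : `|x - u| <= r.
  apply: (le_trans xu); apply: le_r; rewrite opprD addNKr normrN na.
  by rewrite ler_peMr ?lerDl// divr_ge0// ltW.
have /choice[v vP] : forall n, exists vn,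
    P vn (z + a + (a + d n)) /\ `|u - vn| <= r.
  move=> n; have [vn Pv uv] := lc u (z + a) (z + a + (a + d n)) Pu.
  exists vn; split => //; apply: (le_trans uv); apply: le_r.
  by rewrite opprD addNKr normrN.
have [s1 Hd] := Ht t r s t0t erefl erefl.
have s0 : 0 < s by exact: lt_le_trans s1.
(* The Lipschitz bound gives 2s <= |v n - v k| + 1, and s >= 1 absorbs the 1. *)
have sep n k : n != k -> s <= `|v n - v k|.
  move=> nk; have [Pn _] := vP n; have [Pk _] := vP k.
  have := le_trans (dsep _ _ nk) _; move=> /(_ (L * (`|v n - v k| + 1))).
  have -> : d n - d k = z + a + (a + d n) - (z + a + (a + d k)).
    by rewrite opprD addrACA subrr add0r opprD addrACA subrr add0r.
  move=> /(_ (lipP Pn Pk)); rewrite -ler_pdivrMl// => h1.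
  have h2 : L^-1 * (tau * t) = 2 * s by rewrite /s; field; rewrite lt0r_neq0.
  by move: h1; rewrite h2; lra.
have vr n : `|v n - u| <= r by rewrite distrC; case: (vP n).
have [n xvn] := betaX s0 xu vr sep.
have [Pvn _] := vP n.
(* As z' - z = 3a, the remaining leg is a - d n. *)
have [w Pw vw] := lc (v n) _ z' Pvn; exists w => //.
have {}vw : `|v n - w| <= r.
  apply: (le_trans vw); apply: le_r.
  have -> : z + a + (a + d n) - z' = - (a - d n).
    have z'E : z' - z = a + (a + a).
      by rewrite -mulr2n -mulrS -scaler_nat scalerA divff ?scale1r.
    have -> : z + a + (a + d n) - z' = a + (a + d n) - (z' - z).
      rewrite opprB [RHS]addrA; congr (_ - z').
      by rewrite [RHS]addrC [RHS]addrA.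
    by rewrite z'E opprD addrACA subrr add0r opprD addrACA subrr add0r opprB.
  by rewrite normrN.
have := Hd _ (normr_ge0 _) xvn.
have : `|x - w| <= `|x - v n| + `|v n - w|.
  by rewrite (le_trans _ (ler_normD _ _))// subrKA.
have : 0 <= c * mu * t0 by rewrite !mulr_ge0// ltW.
lra.
Qed.

Lemma no_coarse_lift (C : R) :
  (exists x z, P x z) -> 0 < C -> ~ lifts P C C.
Proof.
move=> ne C0 lC.
pose G := [set c | exists B, lifts P c B].
have GL : lbound G L^-1 by move=> c [B] /(lifts_ge ne).
have G_inf : has_inf G by split; [exists C; exists C|exists L^-1].
pose D := inf G.
have D0 : 0 < D.
  apply: lt_le_trans (lb_le_inf _ GL); first by rewrite invr_gt0.
  by case: G_inf.
(* The cap 2D admits every rate close to the infimum D. *)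
have [mu mu0 contract] := lifts_contract (mulr_gt0 (ltr0n R 2) D0).
have e0 : 0 < Num.min D (D * mu) by rewrite lt_min D0 mulr_gt0.
have [c [B lB] cD] := inf_adherent e0 G_inf.
have {cD} [cD cDmu] : c < 2 * D /\ c < D + D * mu.
  split; apply: (lt_le_trans cD); rewrite -/D; last first.
    by rewrite lerD2l ge_min lexx orbT.
  by rewrite mulr2n mulrDl mul1r lerD2l ge_min lexx.
have Dc : D <= c by apply: ge_inf; [case: G_inf|exists B].
have c0 : 0 < c by exact: lt_le_trans Dc.
have lB' : lifts P c `|B|.
  move=> x z z' Pxz; have [x' Px' h] := lB x z z' Pxz; exists x' => //.
  by apply: (le_trans h); rewrite lerD2l ler_norm.
have [B' lB''] := contract _ _ c0 (ltW cD) (normr_ge0 B) lB'.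
have : D <= c * (1 - mu) by apply: ge_inf; [case: G_inf|exists B'].
(* The new rate lies below D either way: it is nonpositive, or less than D (1 + mu)(1 - mu). *)
have [m1|m1] := leP 1 mu.
  have : c * (1 - mu) <= 0 by rewrite mulr_ge0_le0 ?(ltW c0)// subr_le0.
  lra.
have : c * (1 - mu) < (D + D * mu) * (1 - mu) by rewrite ltr_pM2r// subr_gt0.
have : 0 <= D * mu * mu by rewrite !mulr_ge0// ltW.
lra.
Qed.

End fork_argument.

(** * Coarse quotient mappings *)

(** The lower bound comes from continuity of the inverse at 0, after rescaling x so that T x has
    norm d/2. *)
Lemma isomorphically_embeds_bounds (R : realType) (X Y : normedModType R) :
  isomorphically_embeds X Y -> exists (T : {linear X -> Y}) (M : R),
    [/\ 0 < M, forall x, `|T x| <= M * `|x| & forall x, `|x| <= M * `|T x|].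
Proof.
move=> [T [Tc _ [S TS Sc]]].
have [M1 M1P] : exists M, forall x, `|T x| <= M * `|x|.
  have /linear_boundedP : bounded_near T (nbhs 0).
    exact/linear_bounded_continuous.
  by move=> h; near +oo_R => M; exists M; near: M.
have [d d0 dP] : exists2 d : R, 0 < d & forall x, `|T x| < d -> `|x| < 1.
  have R0 : range T 0 by exists 0 => //; rewrite linear0.
  have S0 : S 0 = 0 by rewrite -[in LHS](linear0 T) TS.
  have := (subspace_continuousP (range T) S).1 Sc 0 R0.
  rewrite S0 => /cvgr0Pnorm_lt /(_ 1 ltr01).
  rewrite /within /= => /nbhs_norm0P[d /= d0 dP]; exists d => // x xd.
  by rewrite -(TS x); apply: dP => //; exists x.
have d20 : 0 < d / 2 by rewrite divr_gt0.
exists T; exists (Num.max 1 (Num.max M1 (2 / d))); split=> [|x|x].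
- by rewrite lt_max ltr01.
- by apply: (le_trans (M1P x)); rewrite ler_wpM2r// !le_max lexx !orbT.
have [->|x0] := eqVneq x 0; first by rewrite linear0 !normr0 mulr0.
have Tx0 : 0 < `|T x|.
  rewrite normr_gt0; apply: contra_neq x0 => Tx0.
  by rewrite -(TS x) Tx0 -(linear0 T) TS.
apply: (@le_trans _ _ (2 / d * `|T x|)); last first.
  by rewrite ler_wpM2r// !le_max lexx !orbT.
pose w := d / 2 / `|T x|; have w0 : 0 < w by rewrite divr_gt0.
have Twx : `|T (w *: x)| < d.
  rewrite linearZ normrZ gtr0_norm// /w divfK ?gt_eqF//.
  by rewrite ltr_pdivrMr// ltr_pMr// ltr1n.
have := ltW (dP _ Twx); rewrite normrZ gtr0_norm// -ler_pdivlMl// mulr1.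
by rewrite /w invf_div invf_div mulrC.
Unshelve. all: by end_near.
Qed.

(** Lets distances in a normed space be covered by chains of unit steps. *)
Lemma segment_step (R : realType) (V : normedModType R) (x y : V) n :
  `|x - y| <= n.+1%:R ->
  exists2 z, `|x - z| <= 1 & `|z - y| <= n%:R.
Proof.
move=> xy; have n0 : 0 < n.+1%:R :> R by rewrite ltr0n.
exists (x - n.+1%:R^-1 *: (x - y)).
  rewrite opprB addrC subrK normrZ gtr0_norm ?invr_gt0//.
  by rewrite ler_pdivrMl// mulr1.
have -> : x - n.+1%:R^-1 *: (x - y) - y = (n%:R / n.+1%:R) *: (x - y).
  rewrite addrAC -[X in X - _]scale1r -scalerBl; congr (_ *: _).
  have n1 := lt0r_neq0 n0; apply: (mulIf n1).
  by rewrite mulrBl mul1r mulVf// divfK// -natr1 addrK.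
rewrite normrZ ger0_norm ?divr_ge0//.
by rewrite mulrAC ler_pdivrMr// ler_wpM2l.
Qed.

Lemma coarsely_continuous_lipschitz (R : realType) (X Y : normedModType R)
    (f : normed_metric X -> normed_metric Y) :
  coarsely_continuous f -> exists2 s : R, 0 < s &
    forall x y : X, `|(f x : Y) - f y| <= s * (`|x - y| + 1).
Proof.
(* Radius 2 because coarse continuity asks for a strict inequality and the steps may have length
   exactly 1. *)
move=> /(_ 2 (ltr0n _ 2)) [s s0 sP]; exists s => // x y.
have step n : forall x : X, `|x - y| <= n%:R -> `|(f x : Y) - f y| <= s * n%:R.
  elim: n => [|n IH] {}x xy.
    have -> : x = y by apply/eqP; rewrite -subr_eq0 -normr_le0.
    by rewrite subrr normr0 mulr0.
  have [z xz zy] := segment_step xy.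
  rewrite -(subrKA (f z : Y)); apply: (le_trans (ler_normD _ _)).
  rewrite -natr1 mulrDr mulr1 addrC; apply: lerD; first exact: IH.
  apply: ltW; apply: sP; rewrite normed_metricE.
  by rewrite (le_lt_trans xz)// ltr1n.
have xyn : `|x - y| <= (Num.truncn `|x - y|).+1%:R by exact/ltW/truncnS_gt.
apply: (le_trans (step _ _ xyn)); rewrite ler_wpM2l ?(ltW s0)//.
by rewrite -natr1 lerD2r truncn_le.
Qed.

Section coarse_relation.
Context {R : realType} {X Y Z : normedModType R} {T : {linear Z -> Y}}.
Context {f : normed_metric X -> normed_metric Y} {K M : R}.
Context (K0 : 0 <= K) (M0 : 0 < M).
Context (TM : forall z, `|T z| <= M * `|z|) (MT : forall z, `|z| <= M * `|T z|).

(** [K] is the constant of co-coarse continuity, so the point that it provides is again a lift. *)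
Definition near_lift (x : X) (z : Z) := `|T z - f x| <= K.

Lemma near_lift_lipschitz : coarsely_continuous f ->
  exists2 L : R, 0 < L & forall x z x' z', near_lift x z -> near_lift x' z' ->
    `|z - z'| <= L * (`|x - x'| + 1).
Proof.
move=> /coarsely_continuous_lipschitz[s s0 sP].
exists (M * (s + 2 * K)); first by rewrite mulr_gt0// ltr_wpDr// mulr_ge0.
move=> x z x' z' xz xz'; apply: (le_trans (MT _)).
rewrite -mulrA ler_wpM2l ?(ltW M0)// linearB.
have -> : T z - T z' = (T z - f x) + ((f x : Y) - f x') - (T z' - f x').
  by rewrite subrKA opprB subrKA.
have h := le_trans (ler_normB _ _) (lerD (le_trans (ler_normD _ _)
  (lerD xz (sP x x'))) xz').
apply: (le_trans h); have : 0 <= K * `|x - x'| by rewrite mulr_ge0.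
lra.
Qed.

Lemma near_lift_exists :
  co_coarsely_continuous K f -> exists x z, near_lift x z.
Proof.
move=> cof; have e0 : 0 < `|f 0 : Y| + 1 by rewrite ltr_wpDl.
have [d d0 dP] := cof _ e0.
have [] := dP 0 (T 0).
  by rewrite /cball/= normed_metricE linear0 sub0r normrN lerDl.
by move=> _ [x _ <-] xK; exists x, 0.
Qed.

(** A unit step in [Z] moves T z by at most [M], hence stays within M + K of f x. Each step ends at
    a lift with the same [K], so errors do not accumulate along a chain. *)
Lemma near_lift_lifts : co_coarsely_continuous K f ->
  exists2 C, 0 < C & lifts near_lift C C.
Proof.
move=> cof; have [d d0 dP] := cof (M + K) (ltr_wpDr K0 M0).
have step x z z1 : near_lift x z -> `|z - z1| <= 1 ->
    exists2 x1, near_lift x1 z1 & `|x - x1| <= d.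
  move=> xz zz1; have [] := dP x (T z1).
    rewrite /cball/= normed_metricE -(subrKA (T z)).
    apply: (le_trans (ler_normD _ _)); apply: lerD; last exact: xz.
    rewrite -linearB; apply: (le_trans (TM _)).
    by rewrite distrC -[leRHS]mulr1 ler_wpM2l ?(ltW M0).
  move=> _ [x1 xx1 <-] h; exists x1 => //.
  by move: xx1; rewrite /cball/= normed_metricE distrC.
have steps n : forall x z z', near_lift x z -> `|z - z'| <= n%:R ->
    exists2 x', near_lift x' z' & `|x - x'| <= d * n%:R.
  elim: n => [|n IH] x z z' xz zz'.
    exists x; last by rewrite subrr normr0 mulr0.
    by have <- : z = z' by apply/eqP; rewrite -subr_eq0 -normr_le0.
  have [z1 zz1 z1z'] := segment_step zz'.
  have [x1 x1z1 xx1] := step _ _ _ xz zz1.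
  have [x' x'z' x1x'] := IH _ _ _ x1z1 z1z'.
  exists x' => //; rewrite -(subrKA x1) -natr1 mulrDr mulr1 [leRHS]addrC.
  exact: le_trans (ler_normD _ _) (lerD xx1 x1x').
exists d => // x z z' xz.
have zn : `|z - z'| <= (Num.truncn `|z - z'|).+1%:R by exact/ltW/truncnS_gt.
have [x' x'z' h] := steps _ _ _ _ xz zn.
exists x' => //; apply: (le_trans h).
rewrite -[X in _ <= _ + X]mulr1 -mulrDr ler_wpM2l ?(ltW d0)//.
by rewrite -natr1 lerD2r truncn_le.
Qed.

End coarse_relation.

Lemma no_coarse_quotient (R : realType) (p q k : R) (X Y Z : normedModType R) :
  1 < p -> p < q -> 0 < k -> beta_power_type p k X -> has_forks q Z ->
  isomorphically_embeds Z Y ->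
  ~ coarse_quotient (normed_metric Y) (normed_metric X).
Proof.
move=> p1 pq k0 bX fZ /isomorphically_embeds_bounds[T [M [M0 TM MT]]].
move=> [K [f [K0 [cf cof]]]].
have [L L0 lip] := near_lift_lipschitz K0 M0 MT cf.
have [C C0 lC] := near_lift_lifts K0 M0 TM cof.
have ne := near_lift_exists (T := T) cof.
exact: (no_coarse_lift p1 pq L0 k0 bX fZ lip ne C0 lC).
Qed.

Lemma isomorphically_embeds_refl (R : realType) (X : normedModType R) :
  isomorphically_embeds X X.
Proof.
exists (idfun : {linear X -> X}); split.
- by move=> x; exact: cvg_id.
- have -> : range (idfun : X -> X) = setT.
    by apply/seteqP; split => // x _; exists x.
  exact: closedT.
- by exists idfun => //; apply: continuous_subspaceT => x; exact: cvg_id.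
Qed.

Lemma finite_dimensional_regular (R : realType) :
  finite_dimensional (R^o : lmodType R).
Proof.
exists 1%N, (fun=> 1) => v; exists (fun=> v).
by rewrite big_ord1 -[RHS]/(v * 1) mulr1.
Qed.

Theorem corollary4p5 (R : realType) (p q : R) (p_gt1 : 1 < p) (lt_pq : p < q) :
  (forall Y : completeNormedModType R,
     isomorphically_embeds (ell (ltW (lt_trans p_gt1 lt_pq))) Y ->
     forall (I : choiceType) (E : I -> normedModType R),
       (forall i, finite_dimensional (E i)) ->
       ~ coarse_quotient (normed_metric Y)
           (normed_metric (lp_sum (ltW p_gt1) E)))
  /\ ~ coarse_quotient (normed_metric (ell (ltW (lt_trans p_gt1 lt_pq))))
         (normed_metric (ell (ltW p_gt1))).
Proof.
have k0 := beta_const_gt0 p_gt1.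
split=> [Y emb I E fdE|].
  apply: (no_coarse_quotient p_gt1 lt_pq k0 _ _ emb).
    exact: (lp_sum_beta p_gt1 fdE).
  exact: ell_has_forks.
(* Here l_q embeds in itself, and l_p is an l_p-sum of lines. *)
apply: (no_coarse_quotient p_gt1 lt_pq k0 _ _ (isomorphically_embeds_refl _)).
  apply: (lp_sum_beta p_gt1) => _; exact: finite_dimensional_regular.
exact: ell_has_forks.
Qed.
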